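(* Let $a,b,c\in\mathbb{C}$ and for each $d>0$ let $S_d=\begin{pmatrix} a & d\\ cd & b\end{pmatrix}\in M_2(\mathbb{C})$. Then, for each $d>0$, $W(S_d)$ is a closed elliptical disk (including the degenerate case) with foci at $\lambda_1(d)$ and $\lambda_2(d)$, and the lengths of its minor and major axes are $2b_d$ and $2a_d$, respectively, where $$\lambda_1(d)=\frac{a+b+\sqrt{(a-b)^2+4cd^2}}{2},\qquad \lambda_2(d)=\frac{a+b-\sqrt{(a-b)^2+4cd^2}}{2},$$ $$b_d=\frac{1}{2\sqrt2}\sqrt{|a-b|^2+2(1+|c|^2)d^2-\big|(a-b)^2+4cd^2\big|},$$ $$a_d=\frac{1}{2\sqrt2}\sqrt{|a-b|^2+2(1+|c|^2)d^2+\big|(a-b)^2+4cd^2\big|}.$$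
   Context: For $B\in M_2(\mathbb{C})$, the numerical range is $W(B)=\{\langle Bx,x\rangle: x\in\mathbb{C}^2,\ \|x\|=1\}$. The degenerate case of an elliptical disk is that where the minor axis has length zero, i.e. the disk reduces to the line segment joining its foci. The square root of a complex number denotes either of its two square roots (the same choice in $\lambda_1(d)$ and $\lambda_2(d)$). *)

(* Defs.v *)
From mathcomp Require Import all_boot all_order all_algebra.
From mathcomp Require Export complex.
From mathcomp Require Import boolp classical_sets reals.
Set Implicit Arguments.
Unset Strict Implicit.
Unset Printing Implicit Defensive.
Import Order.TTheory GRing.Theory Num.Theory.
Local Open Scope classical_set_scope.
Local Open Scope ring_scope.
Local Open Scope complex_scope.

(* The R-valued modulus; the norm `|z| of R[i] is (modulus z)%:C. *)
Notation modulus := ComplexField.Normc.normc.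

Section NumericalRange.
Variables (R : realType) (n : nat).
Implicit Types (x y : 'cV[R[i]]_n) (B : 'M[R[i]]_n).

(* dotmx is the standard product on row vectors, conjugate-linear on the
   right, whence the transpositions. *)
Definition inner x y : R[i] := dotmx x^T y^T.

Definition l2norm x : R[i] := sqrtC (inner x x).

Definition numerical_range B : set R[i] :=
  [set inner (B *m x) x | x in [set x | l2norm x = 1]].

End NumericalRange.

Definition mx2 (T : Type) (p q r s : T) : 'M[T]_2 :=
  \matrix_(i < 2, j < 2)
    if i == ord0 then (if j == ord0 then p else q)
    else (if j == ord0 then r else s).

Section EllipticalDisk.
Variable R : realType.
Implicit Types (f o u : R[i]) (E : set R[i]).

Definition focal_disk f1 f2 (s : R) : set R[i] :=
  [set z | modulus (z - f1) + modulus (z - f2) <= s].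

Definition line o u : set R[i] := [set o + t%:C * u | t in [set: R]].

(* For u of modulus 1 and l >= 0, the segment of length l with midpoint o and
   direction u. *)
Definition centered_segment o u (l : R) : set R[i] :=
  [set o + t%:C * u | t in [set t : R | `|t| <= l / 2]].

(* The two axes are the chords of E through the midpoint o of the foci: the
   major one in the direction u of the line of foci, the minor one in the
   orthogonal direction 'i * u. If f1 = f2 then E is a round disk, and u may be
   any unit vector. The case s = modulus (f1 - f2), in which E is the segment
   joining the foci, is allowed; s < modulus (f1 - f2), in which E would be
   empty, is not. *)
Definition is_elliptical_disk E f1 f2 (minor major : R) : Prop :=
  exists s : R, exists u : R[i],
    let o := (f1 + f2) / 2 in
    [/\ modulus (f1 - f2) <= s,
        E = focal_disk f1 f2 s,
        modulus u = 1 /\ f1 - f2 = (modulus (f1 - f2))%:C * u,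
        E `&` line o u = centered_segment o u major
      & E `&` line o ('i * u) = centered_segment o ('i * u) minor].

End EllipticalDisk.

(* Main.v *)
Require Import Defs.
From mathcomp Require Import all_boot all_order all_algebra.
From mathcomp Require Import boolp classical_sets reals.
From mathcomp Require Import ring lra.
Set Implicit Arguments.
Unset Strict Implicit.
Unset Printing Implicit Defensive.
Import Order.TTheory GRing.Theory Num.Theory.
Local Open Scope ring_scope.
Local Open Scope complex_scope.

(** The field of values of a 2x2 matrix is a planar shadow of a sphere. A unit
    vector [(x1, x2)] enters [<Bx,x>] only through [|x1|^2 - |x2|^2 = P] and
    [2 x2 conj(x1) = X + iY], and [(P, X, Y)] runs over the whole unit sphere
    of R^3 (the Hopf map onto the Bloch sphere). For [B = (p q; r s)] this gives

      [<Bx,x> = (p+s)/2 + (p-s)/2 P + (q+r)/2 X + i(q-r)/2 Y]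

    (lemma [numerical_range_mx2]), so the numerical range is the image of the
    sphere under an affine map of R^3 onto the plane.

    Let [l0, l1, l2] be the three complex coefficients of that map. Then
    [l0^2 + l1^2 + l2^2 = ((p-s)^2 + 4qr)/4 = (rho/2)^2], where [rho] is the
    difference of the eigenvalues. Let [u] be the direction of [rho]; after
    division of the coefficients by [u] this sum is the real number
    [e^2 = |rho/2|^2]. Its imaginary part vanishes, so the vectors [g] and [h]
    of the real and imaginary parts of the coefficients are orthogonal; its real
    part says that [|g|^2 - |h|^2 = e^2], while [|g|^2 + |h|^2] is the sum of the
    squared moduli. These two equations give the squares [A^2] and [B^2] of the
    semi-axes as [|g|^2] and [|h|^2].

    The image of the sphere under [v |-> (g.v, h.v)] with [g] and [h] orthogonal
    is the filled ellipse with semi-axes [|g|] and [|h|] along the coordinate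
    axes ([sphere_image]): the Bessel inequality gives one inclusion; for the
    other, a point is lifted to the span of [g] and [h] and moved onto the sphere
    along a common normal. As [A^2 = B^2 + e^2], squaring twice identifies that
    ellipse with the focal disk of foci [+e] and [-e] and distance sum [2A]
    ([focal_sum_le]). The eigenvalues are the points [+e] and [-e] in the
    coordinates of origin [(p+s)/2] and direction [u], which proves the elliptical
    range theorem for all 2x2 matrices ([elliptical_range]). *)

(** * Linear images of the unit sphere of R^3 *)

(** The inequality [x^2/A^2 + y^2/B^2 <= 1] without denominators. The bounds on
    [x] and [y] follow from it when [A] and [B] are nonzero, and make this the
    right set, a segment or a point, when one of them vanishes. *)
Definition in_ellipse (R : rcfType) (A B x y : R) : bool :=
  [&& x ^+ 2 <= A ^+ 2, y ^+ 2 <= B ^+ 2 &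
      B ^+ 2 * x ^+ 2 + A ^+ 2 * y ^+ 2 <= A ^+ 2 * B ^+ 2].

(** The 3x2 matrix with columns [g] and [h] has rank at most 2, so its left kernel
    contains a nonzero vector, which is normalised. Unlike the cross product of
    [g] and [h], this also works when they are dependent. *)
Lemma unit_normal3 (R : rcfType) (g1 g2 g3 h1 h2 h3 : R) :
  exists n1 n2 n3 : R, [/\ n1 ^+ 2 + n2 ^+ 2 + n3 ^+ 2 = 1,
    g1 * n1 + g2 * n2 + g3 * n3 = 0 & h1 * n1 + h2 * n2 + h3 * n3 = 0].
Proof.
pose M : 'M[R]_(3, 2) := \matrix_(i, j)
  nth 0 (if j == ord0 then [:: g1; g2; g3] else [:: h1; h2; h3]) i.
have kerM : kermx M != 0.
  rewrite kermx_eq0 /row_free neq_ltn; apply/orP; left.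
  by rewrite ltnS rank_leq_col.
have /rV0Pn[k nk0] : nz_row (kermx M) != 0 by rewrite nz_row_eq0.
have /sub_kermxP nM0 := nz_row_sub (kermx M).
set n := nz_row _ in nk0 nM0.
pose q := \sum_i n 0 i ^+ 2.
have q_gt0 : 0 < q.
  rewrite /q (bigD1 k) //= ltr_pwDl ?exprn_even_gt0 //.
  by apply: sumr_ge0 => i _; exact: sqr_ge0.
have nM j : \sum_i n 0 i * M i j = 0.
  by have /matrixP/(_ 0 j) := nM0; rewrite !mxE.
pose m i := n 0 i / Num.sqrt q.
exists (m ord0), (m (lift ord0 ord0)), (m (lift ord0 (lift ord0 ord0))).
have := (nM 0, nM 1); rewrite !big_ord_recl !big_ord0 !mxE /= !addr0.
case=> g0 h0.
have q_sum : q = n 0 ord0 ^+ 2 + n 0 (lift ord0 ord0) ^+ 2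
    + n 0 (lift ord0 (lift ord0 ord0)) ^+ 2.
  by rewrite /q !big_ord_recl big_ord0 addr0 addrA.
rewrite /m; split.
- rewrite !exprMn -!mulrDl -q_sum exprVn sqr_sqrtr ?(ltW q_gt0) //.
  by rewrite divff ?gt_eqF.
- by rewrite !mulrA -!mulrDl; rewrite -[RHS](mul0r (Num.sqrt q)^-1) -g0; ring.
- by rewrite !mulrA -!mulrDl; rewrite -[RHS](mul0r (Num.sqrt q)^-1) -h0; ring.
Qed.

(** With [s = B^2 (g.v)^2 + A^2 (h.v)^2], the vector
    [w = B^2 (g.v) g + A^2 (h.v) h] satisfies [w.v = s] and [|w|^2 = A^2 B^2 s],
    by orthogonality; Cauchy-Schwarz then gives [s <= A^2 B^2], even for
    [A = 0] or [B = 0]. Conversely, [x/A^2 g + y/B^2 h + t n] with [n] a unit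
    normal to [g] and [h] is a preimage of [(x, y)], where [t] is chosen to
    make it a unit vector. *)
Lemma sphere_image (R : rcfType) (g1 g2 g3 h1 h2 h3 A B x y : R) :
    g1 ^+ 2 + g2 ^+ 2 + g3 ^+ 2 = A ^+ 2 ->
    h1 ^+ 2 + h2 ^+ 2 + h3 ^+ 2 = B ^+ 2 ->
    g1 * h1 + g2 * h2 + g3 * h3 = 0 ->
  (exists v1 v2 v3 : R, [/\ v1 ^+ 2 + v2 ^+ 2 + v3 ^+ 2 = 1,
     g1 * v1 + g2 * v2 + g3 * v3 = x & h1 * v1 + h2 * v2 + h3 * v3 = y])
  <-> in_ellipse A B x y.
Proof.
rewrite /in_ellipse; move: (A ^+ 2) (B ^+ 2) => a b gA hB gh0.
have a_ge0 : 0 <= a by rewrite -gA !addr_ge0 ?sqr_ge0.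
have b_ge0 : 0 <= b by rewrite -hB !addr_ge0 ?sqr_ge0.
have CS (w1 w2 w3 v1 v2 v3 : R) : v1 ^+ 2 + v2 ^+ 2 + v3 ^+ 2 = 1 ->
    (w1 * v1 + w2 * v2 + w3 * v3) ^+ 2 <= w1 ^+ 2 + w2 ^+ 2 + w3 ^+ 2.
  move=> v1E; rewrite -[leRHS]mulr1 -v1E -subr_ge0.
  rewrite (_ : _ - _ = (w1 * v2 - w2 * v1) ^+ 2 + (w1 * v3 - w3 * v1) ^+ 2
                       + (w2 * v3 - w3 * v2) ^+ 2); last by ring.
  by rewrite !addr_ge0 ?sqr_ge0.
split=> [[v1 [v2 [v3 [v_unit <- <-]]]]|/and3P[xa yb xy]].
  set gv := g1 * v1 + _ + _; set hv := h1 * v1 + _ + _.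
  have gv_le : gv ^+ 2 <= a by rewrite -gA CS.
  have hv_le : hv ^+ 2 <= b by rewrite -hB CS.
  rewrite gv_le hv_le /=.
  have : (b * gv ^+ 2 + a * hv ^+ 2) ^+ 2 <=
      (b * gv ^+ 2 + a * hv ^+ 2) * (a * b).
    have -> : b * gv ^+ 2 + a * hv ^+ 2 =
        (b * gv * g1 + a * hv * h1) * v1 + (b * gv * g2 + a * hv * h2) * v2
        + (b * gv * g3 + a * hv * h3) * v3 by rewrite /gv /hv; ring.
    apply: le_trans (CS _ _ _ _ _ _ v_unit) _.
    rewrite (_ : _ + _ = b ^+ 2 * gv ^+ 2 * (g1 ^+ 2 + g2 ^+ 2 + g3 ^+ 2)
      + a ^+ 2 * hv ^+ 2 * (h1 ^+ 2 + h2 ^+ 2 + h3 ^+ 2)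
      + 2 * a * b * gv * hv * (g1 * h1 + g2 * h2 + g3 * h3)); last by ring.
    rewrite gA hB gh0 le_eqVlt; apply/orP; left; apply/eqP.
    by rewrite /gv /hv; ring.
  have : 0 <= b * gv ^+ 2 + a * hv ^+ 2.
    by apply: addr_ge0; apply: mulr_ge0; rewrite ?sqr_ge0.
  rewrite le_eqVlt => /predU1P[<- _|s_gt0]; first exact: mulr_ge0.
  by rewrite expr2 ler_pM2l.
have [n1 [n2 [n3 [n_unit gn hn]]]] := unit_normal3 g1 g2 g3 h1 h2 h3.
(* The inverse of 0 being 0, these two laws, valid for s = 0 too, let the same
   preimage serve for degenerate ellipses. *)
have divvK (s t : R) : t ^+ 2 <= s -> s / s * t = t.
  have [->|s0 _] := eqVneq s 0; last by rewrite divff // mul1r.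
  rewrite le_eqVlt sqrf_eq0 ltNge sqr_ge0 orbF => /eqP->.
  by rewrite mulr0.
have divV2 (s : R) : s * s^-1 ^+ 2 = s^-1.
  have [->|s0] := eqVneq s 0; first by rewrite invr0 mul0r.
  by rewrite expr2 mulrA divff // mul1r.
have t_ge0 : 0 <= 1 - x ^+ 2 / a - y ^+ 2 / b.
  have [a0|a0] := eqVneq a 0; have [b0|b0] := eqVneq b 0.
  - by rewrite a0 b0 invr0 !mulr0 !subr0 ler01.
  - by rewrite a0 invr0 mulr0 subr0 subr_ge0 ler_pdivrMr ?mul1r // lt0r b0.
  - by rewrite b0 invr0 mulr0 subr0 subr_ge0 ler_pdivrMr ?mul1r // lt0r a0.
  have ab_gt0 : 0 < a * b by rewrite mulr_gt0 // lt0r ?a0 ?b0.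
  rewrite -(pmulr_rge0 _ ab_gt0).
  rewrite (_ : _ * (_ - _) = a * b - (b * x ^+ 2 + a * y ^+ 2)) ?subr_ge0 //.
  by field; rewrite a0 b0.
pose t := Num.sqrt (1 - x ^+ 2 / a - y ^+ 2 / b).
have tE : t ^+ 2 = 1 - x ^+ 2 / a - y ^+ 2 / b by exact: sqr_sqrtr.
pose v g h n := x / a * g + y / b * h + t * n.
exists (v g1 h1 n1), (v g2 h2 n2), (v g3 h3 n3); rewrite /v; split.
- rewrite (_ : _ + _ = x ^+ 2 * a^-1 ^+ 2 * (g1 ^+ 2 + g2 ^+ 2 + g3 ^+ 2)
    + y ^+ 2 * b^-1 ^+ 2 * (h1 ^+ 2 + h2 ^+ 2 + h3 ^+ 2)
    + t ^+ 2 * (n1 ^+ 2 + n2 ^+ 2 + n3 ^+ 2)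
    + 2 * (x / a) * (y / b) * (g1 * h1 + g2 * h2 + g3 * h3)
    + 2 * (x / a) * t * (g1 * n1 + g2 * n2 + g3 * n3)
    + 2 * (y / b) * t * (h1 * n1 + h2 * n2 + h3 * n3)); last by ring.
  rewrite gA hB gh0 gn hn n_unit tE.
  rewrite -![_ * _^-1 ^+ 2 * _]mulrA ![_^-1 ^+ 2 * _]mulrC !divV2.
  by ring.
- rewrite -[RHS](divvK a) //.
  rewrite (_ : _ + _ = x / a * (g1 ^+ 2 + g2 ^+ 2 + g3 ^+ 2)
    + y / b * (g1 * h1 + g2 * h2 + g3 * h3)
    + t * (g1 * n1 + g2 * n2 + g3 * n3)); last by ring.
  by rewrite gA gh0 gn; ring.
- rewrite -[RHS](divvK b) //.
  rewrite (_ : _ + _ = y / b * (h1 ^+ 2 + h2 ^+ 2 + h3 ^+ 2)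
    + x / a * (g1 * h1 + g2 * h2 + g3 * h3)
    + t * (h1 * n1 + h2 * n2 + h3 * n3)); last by ring.
  by rewrite hB gh0 hn; ring.
Qed.

(** * Ellipses given by their foci *)

(** Let [P] and [Q] be the distances to the foci. Squaring turns [P + Q <= 2A]
    into [PQ <= D] with [D = 2A^2 - x^2 - y^2 - e^2], and squaring again turns
    this into [0 <= D] and [P^2 Q^2 <= D^2]. The second is the inequality of the
    ellipse, because [D^2 - P^2 Q^2 = 4 (A^2 B^2 - B^2 x^2 - A^2 y^2)]. *)
Lemma focal_sum_le (R : rcfType) (A B e x y : R) :
    0 <= A -> A ^+ 2 = B ^+ 2 + e ^+ 2 ->
  (modulus ((x - e) +i* y) + modulus ((x + e) +i* y) <= 2 * A)
  = in_ellipse A B x y.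
Proof.
move=> A_ge0 ABe; rewrite /in_ellipse /=.
set P2 := (x - e) ^+ 2 + y ^+ 2; set Q2 := (x + e) ^+ 2 + y ^+ 2.
have P2_ge0 : 0 <= P2 by rewrite addr_ge0 ?sqr_ge0.
have Q2_ge0 : 0 <= Q2 by rewrite addr_ge0 ?sqr_ge0.
rewrite -(@ler_pXn2r _ 2) ?nnegrE ?addr_ge0 ?sqrtr_ge0 ?mulr_ge0 //.
pose D := 2 * A ^+ 2 - (x ^+ 2 + y ^+ 2 + e ^+ 2).
have -> : ((Num.sqrt P2 + Num.sqrt Q2) ^+ 2 <= (2 * A) ^+ 2) =
    (Num.sqrt (P2 * Q2) <= D).
  rewrite sqrrD !sqr_sqrtr // sqrtrM // /D.
  by apply/idP/idP; rewrite /P2 /Q2; lra.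
have -> : (Num.sqrt (P2 * Q2) <= D) = (0 <= D) && (P2 * Q2 <= D ^+ 2).
  have [D_ge0|D_lt0] := leP 0 D; last first.
    by apply/negbTE; rewrite -ltNge (lt_le_trans D_lt0) ?sqrtr_ge0.
  rewrite -(@ler_pXn2r _ 2) ?nnegrE ?sqrtr_ge0 //.
  by rewrite sqr_sqrtr ?mulr_ge0.
have -> : (P2 * Q2 <= D ^+ 2) =
    (B ^+ 2 * x ^+ 2 + A ^+ 2 * y ^+ 2 <= A ^+ 2 * B ^+ 2).
  rewrite -subr_ge0 -[RHS]subr_ge0.
  rewrite -(@pmulr_rge0 _ 4 (A ^+ 2 * B ^+ 2 - _)) //.
  congr (0 <= _); rewrite /P2 /Q2 /D.
  have -> : A ^+ 2 * B ^+ 2 = A ^+ 2 * (A ^+ 2 - e ^+ 2) by rewrite ABe; ring.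
  rewrite (_ : B ^+ 2 = A ^+ 2 - e ^+ 2); last by rewrite ABe; ring.
  by ring.
(* Given this inequality, 0 <= D is equivalent to the bounds on x and y; only
   the degenerate cases A = 0 and B = 0 need 0 <= D to recover the bounds. *)
rewrite andbA; apply/andP/andP => [[D_ge0 xyAB]|[/andP[xA yB] xyAB]];
  split=> //; last by rewrite /D; lra.
move: D_ge0 xyAB; rewrite /D.
have := sqr_ge0 x; have := sqr_ge0 y; have := sqr_ge0 e; have := sqr_ge0 B.
move: ABe; move: (x ^+ 2) (y ^+ 2) (e ^+ 2) (A ^+ 2) (B ^+ 2) => X Y E a b.
move=> ab b_ge0 E_ge0 Y_ge0 X_ge0 D_ge0 xyAB.
apply/andP; split.
- have [b0|b_neq0] := eqVneq b 0; first by lra.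
  have b_gt0 : 0 < b by rewrite lt0r b_neq0.
  by rewrite -(ler_pM2l b_gt0); nra.
- have [a0|a_neq0] := eqVneq a 0; first by lra.
  have a_gt0 : 0 < a by rewrite lt0r a_neq0; lra.
  by rewrite -(ler_pM2l a_gt0); nra.
Qed.

Lemma in_ellipse_major (R : rcfType) (A B t : R) : 0 <= A ->
  in_ellipse A B t 0 = (`|t| <= A).
Proof.
move=> A_ge0; rewrite /in_ellipse expr0n /= mulr0 addr0 sqr_ge0 /=.
rewrite -(@ler_pXn2r _ 2 _ `|t|) ?nnegrE // real_normK ?num_real //.
by apply/andb_idr => tA; rewrite mulrC ler_wpM2r ?sqr_ge0.
Qed.

Lemma in_ellipseC (R : rcfType) (A B x y : R) :
  in_ellipse A B x y = in_ellipse B A y x.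
Proof. by rewrite /in_ellipse andbCA addrC [A ^+ 2 * B ^+ 2]mulrC. Qed.

Lemma normc_sqr (R : rcfType) (z : R[i]) :
  modulus z ^+ 2 = complex.Re z ^+ 2 + complex.Im z ^+ 2.
Proof. by case: z => x y; rewrite sqr_sqrtr // addr_ge0 ?sqr_ge0. Qed.

Lemma modulus_ge0 (R : rcfType) (z : R[i]) : 0 <= modulus z.
Proof. by case: z => x y; exact: sqrtr_ge0. Qed.

Lemma normc_real (R : rcfType) (x : R) : 0 <= x -> modulus x%:C = x.
Proof. by move=> x_ge0; rewrite /= expr0n addr0 sqrtr_sqr ger0_norm. Qed.

Lemma unit_neq0 (R : rcfType) (u : R[i]) : modulus u = 1 -> u != 0.
Proof.
by move=> u1; apply: contra_eq_neq u1 => ->; rewrite Normc.normc0 eq_sym oner_neq0.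
Qed.

Lemma mul_conj_unit (R : rcfType) (u : R[i]) : modulus u = 1 -> u * u^* = 1.
Proof.
move=> u1; have := normc_sqr u; rewrite u1 expr1n.
case: u {u1} => x y /= E; simpc; apply/eqP; rewrite eq_complex /= -?expr2.
by rewrite -E eqxx /= mulrC addNr.
Qed.

(** In the orthonormal frame of origin [o] and axes [u] and [iu], the foci are the
    points [(e, 0)] and [(-e, 0)], so [focal_sum_le] applies to the modulus of
    differences up to the factor [|u| = 1]; the two axes are the points of the
    ellipse with a zero coordinate. *)
Lemma is_elliptical_disk_of_ellipse (R : realType) (E : set R[i])
    (o u : R[i]) (A B e : R) :
    0 <= A -> 0 <= B -> 0 <= e -> A ^+ 2 = B ^+ 2 + e ^+ 2 -> modulus u = 1 ->
    (forall x y, E (o + (x +i* y) * u) <-> in_ellipse A B x y) ->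
  is_elliptical_disk E (o + e%:C * u) (o - e%:C * u) (2 * B) (2 * A).
Proof.
move=> A_ge0 B_ge0 e_ge0 ABe u1 EP.
have u_conj := mul_conj_unit u1.
have coord z : exists x y, z = o + (x +i* y) * u.
  exists (complex.Re ((z - o) * u^*)), (complex.Im ((z - o) * u^*)).
  have -> : complex.Re ((z - o) * u^*) +i* complex.Im ((z - o) * u^*)
      = (z - o) * u^* by case: (_ * _).
  by rewrite -mulrA [_^* * _]mulrC u_conj; ring.
have u_neq0 := unit_neq0 u1.
have focal x y : modulus (o + (x +i* y) * u - (o + e%:C * u))
    + modulus (o + (x +i* y) * u - (o - e%:C * u)) =
    modulus ((x - e) +i* y) + modulus ((x + e) +i* y).
  congr (_ + _).
    rewrite (_ : _ - _ = ((x - e) +i* y) * u) ?Normc.normcM ?u1 ?mulr1 //.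
    rewrite (_ : (x - e) +i* y = (x +i* y) - e%:C); first by ring.
    by simpc.
  rewrite (_ : _ - _ = ((x + e) +i* y) * u) ?Normc.normcM ?u1 ?mulr1 //.
  rewrite (_ : (x + e) +i* y = (x +i* y) + e%:C); first by ring.
  by simpc.
have midpoint : (o + e%:C * u + (o - e%:C * u)) / 2 = o by field.
have foci_dist : o + e%:C * u - (o - e%:C * u) = (2 * e)%:C * u.
  by rewrite (_ : (2 * e)%:C = 2 * e%:C); [ring|rewrite rmorphM rmorph_nat].
have foci_mod : modulus (o + e%:C * u - (o - e%:C * u)) = 2 * e.
  by rewrite foci_dist Normc.normcM u1 mulr1 normc_real // mulr_ge0.
have eA : e <= A.
  by rewrite -(@ler_pXn2r _ 2) ?nnegrE // ABe lerDr sqr_ge0.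
have halfK t : 2 * t / 2 = t :> R by field.
exists (2 * A), u => /=; rewrite midpoint foci_mod; split=> //.
- by rewrite ler_pM2l.
- apply/funext => z; apply/propext; have [x [y ->]] := coord z.
  by rewrite EP /focal_disk /= focal (@focal_sum_le _ A B).
- apply/seteqP; split=> z /=.
    case=> Ez [t _ zE]; exists t => //=.
    by rewrite halfK -(in_ellipse_major B) // -EP complexr0 zE.
  case=> t /=; rewrite halfK -(in_ellipse_major B) // => tE <-.
  by split; [exact/(EP t 0)|exists t].
- have iE t : t%:C * ('i%R * u) = (0 +i* t) * u.
    by rewrite -complexiE mulrA; simpc.
  apply/seteqP; split=> z /=.
    case=> Ez [t _ zE]; exists t => //=.
    rewrite halfK -(in_ellipse_major A) // in_ellipseC -EP -iE.
    by rewrite zE.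
  case=> t /=; rewrite halfK -(in_ellipse_major A) // in_ellipseC => tE <-.
  by split; [rewrite iE; exact/(EP 0 t)|exists t].
Qed.

(** * The numerical range of a 2x2 matrix *)

Lemma innerE2 (R : realType) (x y : 'cV[R[i]]_2) :
  inner x y = x 0 0 * (y 0 0)^* + x 1 0 * (y 1 0)^*.
Proof.
rewrite /inner dotmxE !mxE !big_ord_recl big_ord0 addr0 !mxE.
by rewrite (_ : lift ord0 ord0 = 1 :> 'I_2) //; exact: val_inj.
Qed.

Lemma l2norm_eq1 (R : realType) (n : nat) (x : 'cV[R[i]]_n) :
  l2norm x = 1 <-> inner x x = 1.
Proof.
rewrite /l2norm; split=> [x1|->]; last exact: sqrtC1.
by rewrite -[LHS]sqrtCK x1 expr1n.
Qed.

(** Surjectivity of the Hopf map from the unit sphere of C^2 onto that of R^3. The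
    phase of the vector is free, so its first entry [t] may be taken real and
    nonnegative; then [t^2 = (1 + P) / 2], and the second entry is
    [(X + iY) / (2t)]. Only the south pole, where [t = 0], is treated apart. *)
Lemma bloch_sphere (R : rcfType) (P X Y : R) : P ^+ 2 + X ^+ 2 + Y ^+ 2 = 1 ->
  exists x1 y1 x2 y2 : R,
    [/\ x1 ^+ 2 + y1 ^+ 2 = (1 + P) / 2, x2 ^+ 2 + y2 ^+ 2 = (1 - P) / 2,
        x2 * x1 + y2 * y1 = X / 2 & y2 * x1 - x2 * y1 = Y / 2].
Proof.
move=> PXY.
have [P1|P_neq] := eqVneq P (-1).
  have /eqP : X ^+ 2 + Y ^+ 2 = 0.
    by move: PXY; rewrite P1 sqrrN expr1n -addrA => /(canRL (addKr _)) ->; ring.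
  rewrite paddr_eq0 ?sqr_ge0 // !sqrf_eq0 => /andP[/eqP-> /eqP->].
  by exists 0, 0, 1, 0; rewrite P1; split; field.
have P_gt : 0 < (1 + P) / 2.
  rewrite divr_gt0 // lt0r addrC addr_eq0 P_neq /= leNgt; apply/negP => P_lt.
  by have := sqr_ge0 X; have := sqr_ge0 Y; nra.
pose t := Num.sqrt ((1 + P) / 2).
have t_neq0 : t != 0 by rewrite sqrtr_eq0 -ltNge.
have tE : t ^+ 2 = (1 + P) / 2 by rewrite sqr_sqrtr ?ltW.
exists t, 0, (X / (2 * t)), (Y / (2 * t)); split.
- by rewrite expr0n addr0.
- have PE : P = 2 * t ^+ 2 - 1 by rewrite tE; field.
  have XY : X ^+ 2 + Y ^+ 2 = 1 - P ^+ 2 by rewrite -PXY; ring.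
  rewrite (_ : _ + _ = (X ^+ 2 + Y ^+ 2) / (4 * t ^+ 2)); last by field.
  by rewrite XY PE; field.
- by field.
- by field.
Qed.

(** The quadratic form depends on a unit vector only through its image
    under the Hopf map, and does so affinely. *)
Lemma numerical_range_mx2 (R : realType) (p q r s z : R[i]) :
  numerical_range (mx2 p q r s) z <->
  exists P X Y : R, P ^+ 2 + X ^+ 2 + Y ^+ 2 = 1 /\
    z = (p + s) / 2 + ((p - s) / 2 * P%:C + (q + r) / 2 * X%:C
                       + 'i%C * (q - r) / 2 * Y%:C).
Proof.
have form (x : 'cV[R[i]]_2) x1 y1 x2 y2 :
    x 0 0 = x1 +i* y1 -> x 1 0 = x2 +i* y2 ->
    inner (mx2 p q r s *m x) x =
    p * (x1 ^+ 2 + y1 ^+ 2)%:C + s * (x2 ^+ 2 + y2 ^+ 2)%:C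
    + (q + r) * (x2 * x1 + y2 * y1)%:C
    + 'i%C * (q - r) * (y2 * x1 - x2 * y1)%:C.
  move=> x1E x2E; rewrite innerE2 !mxE !big_ord_recl !big_ord0 !addr0 !mxE /=.
  rewrite (_ : lift ord0 ord0 = 1 :> 'I_2); last exact: val_inj.
  rewrite x1E x2E; move: p q r s => [p1 p2] [q1 q2] [r1 r2] [s1 s2]; simpc.
  by apply/eqP; rewrite eq_complex /=; apply/andP; split; apply/eqP; ring.
have norm (x : 'cV[R[i]]_2) x1 y1 x2 y2 :
    x 0 0 = x1 +i* y1 -> x 1 0 = x2 +i* y2 ->
    inner x x = (x1 ^+ 2 + y1 ^+ 2 + (x2 ^+ 2 + y2 ^+ 2))%:C.
  move=> x1E x2E; rewrite innerE2 x1E x2E; simpc.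
  by apply/eqP; rewrite eq_complex /=; apply/andP; split; apply/eqP; ring.
split.
- case=> x /= /l2norm_eq1.
  case x1E : (x 0 0) => [x1 y1]; case x2E : (x 1 0) => [x2 y2].
  rewrite (norm _ _ _ _ _ x1E x2E) (form _ _ _ _ _ x1E x2E).
  move=> [x_unit] <-.
  exists (x1 ^+ 2 + y1 ^+ 2 - (x2 ^+ 2 + y2 ^+ 2)),
    (2 * (x2 * x1 + y2 * y1)), (2 * (y2 * x1 - x2 * y1)); split.
    transitivity ((x1 ^+ 2 + y1 ^+ 2 + (x2 ^+ 2 + y2 ^+ 2)) ^+ 2).
      by ring.
    by rewrite x_unit expr1n.
  have -> : x2 ^+ 2 + y2 ^+ 2 = 1 - (x1 ^+ 2 + y1 ^+ 2).
    by rewrite -x_unit; ring.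
  move: (x1 ^+ 2 + y1 ^+ 2) (x2 * x1 + y2 * y1) (y2 * x1 - x2 * y1) => n1 re im.
  by rewrite !(rmorphB, rmorphM, rmorph1, rmorph_nat); field.
case=> P [X [Y [/bloch_sphere[x1 [y1 [x2 [y2 [n1 n2 re im]]]]] ->]]].
pose x : 'cV[R[i]]_2 := \col_i (if i == ord0 then x1 +i* y1 else x2 +i* y2).
have x1E : x 0 0 = x1 +i* y1 by rewrite mxE.
have x2E : x 1 0 = x2 +i* y2 by rewrite mxE.
exists x => /=.
  apply/l2norm_eq1; rewrite (norm _ _ _ _ _ x1E x2E) n1 n2.
  by rewrite (_ : _ + _ = 1) //; field.
rewrite (form _ _ _ _ _ x1E x2E) n1 n2 re im.
by rewrite !(rmorphB, rmorphD, rmorphM, fmorphV, rmorph1, rmorph_nat); field.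
Qed.

(** The elliptical range theorem. The two equations for the semi-axes are
    solved from [A^2 - B^2 = |rho|^2 / 4], the squared half-distance of the
    foci, and from [4 (A^2 + B^2) = |p-s|^2 + 2 (|q|^2 + |r|^2)], the sum of the
    squared moduli of the coefficients in [numerical_range_mx2]. *)
Theorem elliptical_range (R : realType) (p q r s rho : R[i]) (A B : R) :
    rho ^+ 2 = (p - s) ^+ 2 + 4 * q * r -> 0 <= A -> 0 <= B ->
    8 * A ^+ 2 = modulus (p - s) ^+ 2 + 2 * (modulus q ^+ 2 + modulus r ^+ 2)
                 + modulus rho ^+ 2 ->
    8 * B ^+ 2 = modulus (p - s) ^+ 2 + 2 * (modulus q ^+ 2 + modulus r ^+ 2)
                 - modulus rho ^+ 2 ->
  is_elliptical_disk (numerical_range (mx2 p q r s))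
    ((p + s + rho) / 2) ((p + s - rho) / 2) (2 * B) (2 * A).
Proof.
move=> rho2 A_ge0 B_ge0 A2 B2.
pose e := modulus rho / 2.
(* When rho = 0 the range is a round disk or a point, and any direction will
   do for u. *)
have [u u1 rhoE] : exists2 u, modulus u = 1 & rho = (modulus rho)%:C * u.
  have [->|rho_neq0] := eqVneq rho 0.
    by exists 1; rewrite ?Normc.normc1 // Normc.normc0 mul0r.
  have m_neq0 : (modulus rho)%:C != 0.
    by apply: contra_neq rho_neq0 => /eq0_normC.
  exists (rho / (modulus rho)%:C); last by rewrite mulrC divfK.
  have m_ge0 := modulus_ge0 rho.
  rewrite Normc.normcM Normc.normcV normc_real // divff //.
  by apply: contra_neq m_neq0 => ->.
have u_conj := mul_conj_unit u1.
have eC : e%:C * u = rho / 2.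
  by rewrite [in RHS]rhoE /e rmorphM fmorphV rmorph_nat; ring.
have -> : (p + s + rho) / 2 = (p + s) / 2 + e%:C * u by rewrite eC mulrDl.
have -> : (p + s - rho) / 2 = (p + s) / 2 - e%:C * u by rewrite eC mulrBl.
have e2 : e ^+ 2 = modulus rho ^+ 2 / 4 by rewrite /e; field.
have ABe : A ^+ 2 = B ^+ 2 + e ^+ 2 by rewrite e2; lra.
apply: is_elliptical_disk_of_ellipse => //.
  by rewrite divr_ge0 ?modulus_ge0.
move=> x y; rewrite numerical_range_mx2.
(* The coefficients of the affine map, in coordinates of origin (p + s) / 2 and
   axes u, 'i u; multiplication by u^* is division by u. *)
pose l0 := (p - s) / 2 * u^*; pose l1 := (q + r) / 2 * u^*.
pose l2 := 'i%C * (q - r) / 2 * u^*.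
have u_neq0 := unit_neq0 u1.
have l_sqr : l0 ^+ 2 + l1 ^+ 2 + l2 ^+ 2 = (e ^+ 2)%:C.
  rewrite (_ : _ + _ = ((p - s) ^+ 2 + (q + r) ^+ 2 + 'i%C ^+ 2 * (q - r) ^+ 2)
      / 4 * u^* ^+ 2); last by rewrite /l0 /l1 /l2; field.
  rewrite sqr_i.
  rewrite (_ : _ / 4 = (rho / 2) ^+ 2); last by rewrite expr_div_n rho2; field.
  by rewrite -eC exprMn -mulrA -exprMn u_conj expr1n mulr1 rmorphXn.
have two_norm : modulus (2 : R[i]) = 2.
  by rewrite (_ : 2 = 2%:C) ?normc_real // rmorph_nat.
have i_norm : modulus ('i%C : R[i]) = 1.
  by rewrite /= expr0n expr1n add0r sqrtr1.
have conj_norm : modulus u^* = 1.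
  by move: u1; case: (u) => x' y' /=; rewrite sqrrN.
have l_norm : modulus l0 ^+ 2 + modulus l1 ^+ 2 + modulus l2 ^+ 2
    = A ^+ 2 + B ^+ 2.
  rewrite /l0 /l1 /l2 !Normc.normcM Normc.normcV two_norm i_norm conj_norm.
  have pgram : modulus (q + r) ^+ 2 + modulus (q - r) ^+ 2
      = 2 * (modulus q ^+ 2 + modulus r ^+ 2).
    by rewrite !normc_sqr; case: (q) (r) => [? ?] [? ?] /=; ring.
  by rewrite !mulr1 !mul1r !exprMn; lra.
move: l_norm l_sqr; rewrite !normc_sqr.
have zE P X Y : (p + s) / 2 + ((p - s) / 2 * P%:C + (q + r) / 2 * X%:C
      + 'i%C * (q - r) / 2 * Y%:C) =
    (p + s) / 2 + (l0 * P%:C + l1 * X%:C + l2 * Y%:C) * u.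
  have -> : (l0 * P%:C + l1 * X%:C + l2 * Y%:C) * u =
    ((p - s) / 2 * P%:C + (q + r) / 2 * X%:C + 'i%C * (q - r) / 2 * Y%:C)
    * (u * u^*) by rewrite /l0 /l1 /l2; ring.
  by rewrite u_conj mulr1.
move: (l0) (l1) (l2) zE => [g1 h1] [g2 h2] [g3 h3] /= zE l_norm l_sqr.
have [gg_hh gh0] :
    g1 ^+ 2 + g2 ^+ 2 + g3 ^+ 2 - (h1 ^+ 2 + h2 ^+ 2 + h3 ^+ 2) = e ^+ 2
    /\ g1 * h1 + g2 * h2 + g3 * h3 = 0.
  move/eqP: l_sqr; simpc; rewrite eq_complex /= => /andP[/eqP l_re /eqP l_im].
  by split; lra.
rewrite -(@sphere_image _ g1 g2 g3 h1 h2 h3); [|lra|lra|lra].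
split=> [[P [X [Y [PXY xyE]]]]|[P [X [Y [PXY <- <-]]]]]; exists P, X, Y.
  by move: xyE; rewrite zE => /addrI /(mulIf u_neq0); simpc => -[-> ->].
by split=> //; rewrite zE; simpc.
Qed.

Theorem lemma3p3 (R : realType) (a b c : R[i]) (d : R) (hd : 0 < d)
    (r : R[i]) (hr : r ^+ 2 = (a - b) ^+ 2 + 4 * c * d%:C ^+ 2) :
  let S_d := mx2 a d%:C (c * d%:C) b in
  let lambda1 := (a + b + r) / 2 in
  let lambda2 := (a + b - r) / 2 in
  let b_d := 1 / (2 * Num.sqrt 2) *
    Num.sqrt (modulus (a - b) ^+ 2 + 2 * (1 + modulus c ^+ 2) * d ^+ 2
              - modulus ((a - b) ^+ 2 + 4 * c * d%:C ^+ 2)) in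
  let a_d := 1 / (2 * Num.sqrt 2) *
    Num.sqrt (modulus (a - b) ^+ 2 + 2 * (1 + modulus c ^+ 2) * d ^+ 2
              + modulus ((a - b) ^+ 2 + 4 * c * d%:C ^+ 2)) in
  is_elliptical_disk (numerical_range S_d) lambda1 lambda2 (2 * b_d) (2 * a_d).
Proof.
move=> S_d lambda1 lambda2 b_d a_d.
have d_norm : modulus d%:C = d by rewrite normc_real ?ltW.
have d2 : (2 * Num.sqrt 2) ^+ 2 = 8 :> R by rewrite exprMn sqr_sqrtr //; ring.
have axis t : 0 <= t ->
    8 * (1 / (2 * Num.sqrt 2) * Num.sqrt t) ^+ 2 = t :> R.
  by move=> t_ge0; rewrite exprMn exprMn exprVn d2 expr1n sqr_sqrtr //; field.
have r_norm : modulus ((a - b) ^+ 2 + 4 * c * d%:C ^+ 2) = modulus r ^+ 2.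
  by rewrite -hr expr2 Normc.normcM.
(* The radicand of b_d is nonnegative, so that b_d is not a truncated root. *)
have radicand_ge0 : modulus ((a - b) ^+ 2 + 4 * c * d%:C ^+ 2) <=
    modulus (a - b) ^+ 2 + 2 * (1 + modulus c ^+ 2) * d ^+ 2.
  apply: le_trans (le_normcD _ _) _.
  rewrite !expr2 !Normc.normcM d_norm -!expr2.
  rewrite (_ : modulus 4 = 4); last first.
    by rewrite (_ : 4 = 4%:C) ?normc_real // rmorph_nat.
  (* 4 |c| <= 2 (1 + |c|^2), up to the factor d^2 *)
  have := sqr_ge0 ((modulus c - 1) * d); nra.
apply: elliptical_range.
- by rewrite hr; ring.
- by rewrite !mulr_ge0 ?invr_ge0 ?mulr_ge0 ?sqrtr_ge0.
- by rewrite !mulr_ge0 ?invr_ge0 ?mulr_ge0 ?sqrtr_ge0.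
- rewrite axis; first by rewrite r_norm Normc.normcM d_norm; ring.
  by rewrite addr_ge0 ?(le_trans _ radicand_ge0) ?modulus_ge0.
- rewrite axis ?subr_ge0 //.
  by rewrite r_norm Normc.normcM d_norm; ring.
Qed.
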